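(* Let $(X,d,\mu)$ be a metric space equipped with a doubling measure $\mu$. Assume also that $X$ supports an approximate differentiable structure. If $f\in L^1(X)$ is approximately differentiable $\mu$-a.e., then the discrete maximal function $M^{*}f$ is approximately differentiable $\mu$-a.e.
   Context: A metric measure space $(X,d,\mu)$ is a separable metric space $(X,d)$ with a non-trivial, locally finite Borel regular measure $\mu$. $B(x,r)=\{y\in X: d(x,y)<r\}$. The measure $\mu$ is doubling if there is $C_\mu>0$ with $\mu(B(x,2r))\le C_\mu\,\mu(B(x,r))$ for all $x\in X$, $r>0$. For $0<\mu(A)<\infty$, $f_A=\frac1{\mu(A)}\int_A f\,d\mu$. Discrete maximal function. For each $r>0$ let $B_i=B(x_i,r)$, $i=1,2,\dots$, be a collection of balls covering $X$ such that the balls $B(x_i,r/2)$ are pairwise disjoint, and let $\psi_i$ be a partition of unity subordinate to this covering in the sense that $0\le\psi_i\le1$, $\operatorname{supp}\psi_i\subset B(x_i,6r)$, $\psi_i\ge1/C$ in $B(x_i,3r)$, $\psi_i$ is Lipschitz with constant $L/r$, and $\sum_i\psi_i=1$, where $C,L$ are constants depending only on the doubling constant. The discrete convolution of $f\in L^1_{\mathrm{loc}}(X)$ is $f_r(x)=\sum_{i=1}^\infty\psi_i(x)f_{B(x_i,3r)}$, and $|f|_r$ denotes the discrete convolution of $|f|$. Let $r_1,r_2,\dots$ be an enumeration of the positive rationals, and define $M^{*}f(x)=\sup_j|f|_{r_j}(x)$. It depends on the chosen coverings; the theorem is asserted for an arbitrary choice. A point $x$ is a density point of a $\mu$-measurable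 set $A$ if $\lim_{r\to0}\mu(B(x,r)\cap A)/\mu(B(x,r))=1$. We write $\operatorname{ap\,lim}_{y\to x}F(y)=l$ if for every $\varepsilon>0$ the point $x$ is a density point of $\{y:|F(y)-l|<\varepsilon\}$. An approximate differentiable structure on $(X,d,\mu)$ is a countable collection $\{(X_\alpha,\mathbf{x}_\alpha)\}_{\alpha\in\Lambda}$ of measurable sets $X_\alpha\subset X$ and Lipschitz maps $\mathbf{x}_\alpha:X\to\mathbb{R}^{N(\alpha)}$ such that: (i) $\mu(X\setminus\bigcup_\alpha X_\alpha)=0$; (ii) there is $N\ge0$ with $N(\alpha)\le N$ for all $\alpha$; (iii) for every Lipschitz $f:X\to\mathbb{R}$ and every $\alpha$ there is a unique (up to a set of measure zero) measurable bounded $d^\alpha f:X_\alpha\to\mathbb{R}^{N(\alpha)}$ such that for $\mu$-a.e. $x\in X_\alpha$ $$\operatorname{ap\,lim}_{y\to x}\frac{|f(y)-f(x)-d^\alpha f(x)\cdot(\mathbf{x}_\alpha(y)-\mathbf{x}_\alpha(x))|}{d(x,y)}=0.$$ A function $f$ is approximately differentiable at $x\in X_\alpha$ (with respect to this structure) if there is a vector $L^\alpha f(x)\in\mathbb{R}^{N(\alpha)}$ such that $$\operatorname{ap\,lim}_{y\to x}\frac{|f(y)-f(x)-L^\alpha f(x)\cdot(\mathbf{x}_\alpha(y)-\mathbf{x}_\alpha(x))|}{d(x,y)}=0.$$ *)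

(* Defs.v *)
From HB Require Import structures.
From mathcomp Require Import all_boot all_order all_algebra.
From mathcomp Require Import all_classical all_reals all_analysis.
Set Implicit Arguments.
Unset Strict Implicit.
Unset Printing Implicit Defensive.
Import Order.TTheory GRing.Theory Num.Theory.
Import numFieldNormedType.Exports.
Local Open Scope classical_set_scope.
Local Open Scope ring_scope.

(* MathComp-Analysis equips the Caratheodory sigma-algebra of an outer measure
   with its measurableType structure only over a pointed type. Metric measure
   spaces are nonempty since their measure is non-trivial. *)
#[short(type="pmetricType")]
HB.structure Definition PointedMetric (K : numDomainType) :=
  { M of isPointed M & Metric K M }.

Section MetricMeasure.
Context (R : realType) (T : pmetricType R).
Implicit Types (mu : {outer_measure set T -> \bar R}) (A : set T).

(* A Borel regular measure on a metric space is an outer measure, defined on all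
   subsets. "mu-measurable" means Caratheodory measurable, and integrals are
   taken with respect to the restriction of mu to these sets. *)
Definition cara_measure mu : {measure set (caratheodory_type mu) -> \bar R} :=
  mu.

Definition borel_regular mu :=
  (forall B, <<s [set U : set T | open U] >> B -> mu.-cara.-measurable B) /\
  (forall A, exists B,
     [/\ <<s [set U : set T | open U] >> B, A `<=` B & mu B = mu A]).

Definition locally_finite mu :=
  forall x : T, exists2 r : R, 0 < r & (mu (ball x r) < +oo)%E.

Definition separable := exists2 D : set T, countable D & dense D.

Definition metric_measure_space mu :=
  [/\ separable, (0 < mu [set: T])%E, locally_finite mu & borel_regular mu].

Definition doubling mu :=
  exists2 Cmu : R, 0 < Cmu &
    forall (x : T) (r : R), 0 < r ->
      (mu (ball x (2 * r)) <= Cmu%:E * mu (ball x r))%E.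

Definition integrable_fun mu (f : T -> R) :=
  (cara_measure mu).-integrable [set: T] (EFin \o f).

Definition average mu (f : T -> R) A : R :=
  (fine (mu A))^-1 * \int[cara_measure mu]_(y in A) f y.

(* The balls are indexed by a subset of nat: on a bounded space only finitely
   many of the half-radius balls can be disjoint. *)
Record ball_partition := BallPartition {
  bp_index : set nat ;
  bp_center : nat -> T ;
  bp_fun : nat -> T -> R
}.

Definition admissible_partition (C L r : R) (P : ball_partition) :=
  let c := bp_center P in let psi := bp_fun P in let I := bp_index P in
  [/\ \bigcup_(i in I) ball (c i) r = [set: T],
      trivIset I (fun i => ball (c i) (r / 2)),
      forall i, I i ->
        [/\ forall x, 0 <= psi i x <= 1,
            closure [set x | psi i x != 0] `<=` ball (c i) (6 * r),
            forall x, ball (c i) (3 * r) x -> 1 / C <= psi i x &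
            forall x y, `|psi i x - psi i y| <= L / r * mdist x y] &
      forall x, (\sum_(0 <= i <oo | i \in I) (psi i x)%:E)%E = 1%:E].

Definition discrete_convolution mu (P : ball_partition) (r : R) (f : T -> R)
    (x : T) : \bar R :=
  (\sum_(0 <= i <oo | i \in bp_index P)
     (bp_fun P i x * average mu f (ball (bp_center P i) (3 * r)))%:E)%E.

(* P r is the partition chosen at scale r, and rs enumerates the radii. *)
Definition discrete_maximal mu (P : R -> ball_partition) (rs : nat -> R)
    (f : T -> R) (x : T) : \bar R :=
  ereal_sup (range (fun j =>
    discrete_convolution mu (P (rs j)) (rs j) (fun y => `|f y|) x)).

Definition density_point mu A (x : T) :=
  mu.-cara.-measurable A /\
  (fun r : R => fine (mu (ball x r `&` A)) / fine (mu (ball x r))) @ 0^'+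
    --> (1 : R).

Definition ap_lim mu (F : T -> \bar R) (x : T) (l : R) :=
  forall e : R, 0 < e ->
    density_point mu [set y | (`|F y - l%:E| < e%:E)%E] x.

(* For M* the function may take the value +oo; being approximately
   differentiable at x requires a finite value at x. At y = x the quotient is
   0 / 0 = 0 with the library's convention; this matters only at atoms of mu. *)
Definition approx_derivative mu n (X : T -> 'rV[R]_n) (F : T -> \bar R)
    (x : T) (v : 'rV[R]_n) :=
  F x \is a fin_num /\
  ap_lim mu
    (fun y => `|F y - F x - (\sum_(i < n) v 0 i * (X y 0 i - X x 0 i))%:E|
              * ((mdist x y)^-1)%:E)%E x 0.

(* The norm on 'rV[R]_n is the sup norm, equivalent to the Euclidean one. *)
Definition lipschitz_map (V : normedModType R) (f : T -> V) :=
  exists K : R, forall x y, `|f x - f y| <= K * mdist x y.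

Definition is_approx_differential mu (A : set T) n (X : T -> 'rV[R]_n)
    (f : T -> R) (df : T -> 'rV[R]_n) :=
  [/\ forall i, measurable_fun (A : set (caratheodory_type mu))
                  (fun x => df x 0 i),
      exists M : R, forall x, A x -> `|df x| <= M &
      {ae cara_measure mu, forall x, A x ->
        approx_derivative mu X (EFin \o f) x (df x)}].

Section Structure.
Context (Lam : countType) (N : Lam -> nat) (Xs : Lam -> set T).
Context (xs : forall a, T -> 'rV[R]_(N a)).

Definition approx_diff_structure mu :=
  [/\ forall a, mu.-cara.-measurable (Xs a),
      forall a, lipschitz_map (xs a),
      mu (~` \bigcup_a Xs a) = 0%E,
      exists M : nat, forall a, (N a <= M)%N &
      forall f : T -> R, lipschitz_map (f : T -> R^o) ->
        forall a, exists df : T -> 'rV[R]_(N a),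
          is_approx_differential mu (Xs a) (xs a) f df /\
          forall dg : T -> 'rV[R]_(N a),
            is_approx_differential mu (Xs a) (xs a) f dg ->
            {ae cara_measure mu, forall x, Xs a x -> df x = dg x}].

(* Almost every x lies in some Xs a, so the guard loses no mass. *)
Definition approx_differentiable_ae mu (F : T -> \bar R) :=
  {ae cara_measure mu, forall x, forall a, Xs a x ->
    exists v : 'rV[R]_(N a), approx_derivative mu (xs a) F x v}.

End Structure.
End MetricMeasure.

(* Main.v *)
Require Import Defs.
From mathcomp Require Import all_boot all_order all_algebra.
From mathcomp Require Import all_classical all_reals all_analysis.
From mathcomp Require Import measurable_realfun ring lra.
Import Order.TTheory GRing.Theory Num.Theory.
Import numFieldNormedType.Exports.
Local Open Scope classical_set_scope.
Local Open Scope ring_scope.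

(** At almost every point the discrete maximal function takes the value of one of
    countably many functions that are approximately differentiable almost
    everywhere. It inherits their approximate derivatives, because almost every
    point of the measurable set where two functions agree is a density point of
    that set.

    Let [g = |f|]. At a scale [r] the discrete convolution of [g] is a weighted
    mean of averages of [g] over balls of radius [3 * r] that are close to the
    point. At a Lebesgue point [x] of [g] the convolutions hence tend to [g x] as
    the scale tends to zero ([convolution_near], [ae_lebesgue_point]). The
    maximal function at [x] is therefore either [g x], that is [f x] or [- f x],
    or the supremum of the convolutions over the scales above some positive bound
    [s] ([ae_maximal_cases]). On a ball of radius [s] the convolutions at these
    scales are equi-bounded and equi-Lipschitz, by doubling and integrability of
    [f] ([convolution_lipschitz]), so their supremum coincides there with a
    globally Lipschitz function ([maximal_truncation]), and Lipschitz functions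
    are approximately differentiable by the definition of the structure. Bounds
    [s = 1 / (k + 1)] and balls around a dense sequence of centers make the family
    of functions countable, and [approx_differentiable_piecewise] concludes.

    The differentiation theorems rest on one estimate, [ae_small_density]. If the
    balls around points of a bounded part of a measurable set [E] carried a fixed
    fraction of mass outside [E], then a Vitali covering argument
    ([vitali_countable]) would bound the measure of the set of these points by the
    mass outside [E] of any open set that contains this part of [E], and outer
    regularity ([outer_regular]) makes that mass as small as desired. Taking for
    the mass the measure itself gives density points, and taking [|g - q|] on the
    slices of [g] gives Lebesgue points. *)

Set Implicit Arguments.
Unset Strict Implicit.
Unset Printing Implicit Defensive.

(** * Balls in a doubling space *)

Section Balls.
Context (R : realType) (T : pmetricType R).
Implicit Types (x y z : T) (r s : R).

Lemma ballE x r y : ball x r y = (mdist x y < r) :> Prop.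
Proof. by rewrite ballEmdist. Qed.

Lemma dist_triangle x y z : mdist x z <= mdist x y + mdist y z.
Proof. exact: metric_triangle. Qed.

Lemma dist_sym x y : mdist x y = mdist y x.
Proof. exact: metric_sym. Qed.

Lemma subset_ball_dist x y r s :
  mdist x y + r <= s -> ball y r `<=` ball x s.
Proof.
move=> xys z; rewrite !ballE => yz.
by rewrite (le_lt_trans (dist_triangle _ y _))// (lt_le_trans _ xys)// ltrD2l.
Qed.

Lemma open_ball_metric x r : open (ball x r).
Proof.
rewrite openE => y; rewrite ballE => xy.
apply/nbhs_ballP; exists (r - mdist x y); first by rewrite /= subr_gt0.
by apply: subset_ball_dist; rewrite addrC subrK.
Qed.

Lemma ball_exhaust x r : 0 < r -> \bigcup_k ball x (2 ^+ k * r) = [set: T].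
Proof.
move=> r0; apply/seteqP; split => // y _.
exists (Num.truncn (mdist x y / r)).+1 => //; rewrite ballE -ltr_pdivrMr//.
rewrite (lt_le_trans (truncnS_gt _))// -natrX ler_nat.
exact: ltnW (ltn_expl _ _).
Qed.

End Balls.

Section DoublingBalls.
Context (R : realType) (T : pmetricType R) (mu : {outer_measure set T -> \bar R}).
Context (mms : metric_measure_space mu).
Context (D : R) (D0 : 0 < D).
Context (dblD : forall (x : T) (r : R), 0 < r ->
  (mu (ball x (2 * r)) <= D%:E * mu (ball x r))%E).
Implicit Types (x y z : T) (r s : R).
Local Open Scope ereal_scope.

Lemma open_cara (U : set T) : open U -> mu.-cara.-measurable U.
Proof. by move=> oU; have [_ _ _ [+ _]] := mms; apply; exact: sub_sigma_algebra. Qed.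

Lemma ball_cara x r : mu.-cara.-measurable (ball x r).
Proof. exact/open_cara/open_ball_metric. Qed.

Lemma doubling_iter k x r : (0 < r)%R ->
  mu (ball x (2 ^+ k * r)) <= (D ^+ k)%:E * mu (ball x r).
Proof.
move=> r0; elim: k => [|k IH]; first by rewrite !expr0 mul1r mul1e.
rewrite exprS -mulrA (le_trans (dblD _ _))//; first by rewrite mulr_gt0 ?exprn_gt0.
by rewrite exprS EFinM -muleA lee_pmul2l ?lte_fin.
Qed.

(** Some small ball around each point has finite measure, and doubling carries
    finiteness over to its dilates. *)
Lemma ball_fin x r : mu (ball x r) < +oo.
Proof.
have [_ _ /(_ x)[e e0 xe] _] := mms.
pose k := (Num.truncn (r / e)).+1.
have rk : (r <= 2 ^+ k * e)%R.
  rewrite -ler_pdivrMr// (le_trans (ltW (truncnS_gt _)))// -natrX ler_nat.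
  exact: ltnW (ltn_expl _ _).
apply: (@le_lt_trans _ _ (mu (ball x (2 ^+ k * e)))).
  exact/le_outer_measure/le_ball.
rewrite (le_lt_trans (doubling_iter k x e0))// lte_mul_pinfty ?lee_fin//.
by rewrite exprn_ge0// ltW.
Qed.

(** By doubling, a null ball has null concentric dilates, which exhaust the
    space; but the measure is non-trivial. *)
Lemma ball_pos x r : (0 < r)%R -> 0 < mu (ball x r).
Proof.
move=> r0; rewrite lt0e outer_measure_ge0 andbT; apply/negP => /eqP xr0.
have [_ + _ _] := mms; apply/negP; rewrite -leNgt -(ball_exhaust x r0).
apply: (le_trans (outer_measure_sigma_subadditive mu _)).
rewrite eseries0// => k _ _; apply/eqP.
rewrite eq_le outer_measure_ge0 andbT (le_trans (doubling_iter k x r0))//.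
by rewrite xr0 mule0.
Qed.

Lemma ball_fineK x r : (fine (mu (ball x r)))%:E = mu (ball x r).
Proof. by rewrite fineK// ge0_fin_numE ?outer_measure_ge0// ball_fin. Qed.

Lemma fine_ball_gt0 x r : (0 < r)%R -> (0 < fine (mu (ball x r)))%R.
Proof. by move=> r0; rewrite -lte_fin ball_fineK ball_pos. Qed.

(** The form in which doubling is used: a ball that lies in a dilate of another
    one is not much larger than it. *)
Lemma doubling_sub k x y r s : (0 < r)%R -> (mdist y x + s <= 2 ^+ k * r)%R ->
  mu (ball x s) <= (D ^+ k)%:E * mu (ball y r).
Proof.
move=> r0 le; apply: (le_trans _ (doubling_iter k y r0)).
exact/le_outer_measure/subset_ball_dist.
Qed.

End DoublingBalls.

(** * Outer regularity *)

Section Regularity.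
Context (R : realType) (T : pmetricType R) (mu : {outer_measure set T -> \bar R}).
Context (mms : metric_measure_space mu).
Local Open Scope ereal_scope.

(** [~` V] is a closed set inside [A], so this is approximation by open sets
    from outside and by closed sets from inside, for the measure restricted to
    [X0]; in this form it is symmetric in [A] and its complement. *)
Definition approximable (X0 A : set T) := forall e : R, (0 < e)%R ->
  exists U V, [/\ open U, open V, A `<=` U, ~` A `<=` V &
                mu (U `&` V `&` X0) <= e%:E].

Context (X0 : set T) (oX0 : open X0) (fX0 : mu X0 < +oo).

(** Continuity from above on the set [X0] of finite measure. *)
Lemma shrinking_open (F : (set T)^nat) (l e : R) : (forall n, open (F n)) ->
  nonincreasing_seq F -> mu.-cara.-measurable (\bigcap_n (F n `&` X0)) ->
  mu (\bigcap_n (F n `&` X0)) <= l%:E -> (l < e)%R ->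
  exists n, mu (F n `&` X0) <= e%:E.
Proof.
move=> oF nF mF Fl le.
pose G n := F n `&` X0.
have mG n : mu.-cara.-measurable (G n) by apply: (open_cara mms); exact: openI.
have G0 : cara_measure mu (G 0%N) < +oo.
  by rewrite (le_lt_trans _ fX0)//; apply: le_outer_measure; exact: subIsetr.
have nG : nonincreasing_seq G.
  by move=> m n mn; apply/subsetPset; apply: setSI; apply/subsetPset/nF.
have /= := @nonincreasing_cvg_mu _ (caratheodory_type mu) R (cara_measure mu)
  G G0 mG mF nG.
have lt : mu (\bigcap_n G n) < e%:E by rewrite (le_lt_trans Fl)// lte_fin.
move=> /(_ _ (open_ereal_lt' lt))[n _ /(_ n)] /= h; exists n; exact/ltW/h/leqnn.
Qed.

(** The neighbourhoods of radius [1 / (n + 1)] of a closed set are open and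
    shrink to it. *)
Lemma open_approximable (A : set T) : open A -> approximable X0 A.
Proof.
move=> oA e e0.
pose V k := \bigcup_(z in ~` A) ball z (k.+1%:R^-1 : R).
have oV k : open (V k) by apply: bigcup_open => z _; exact: open_ball_metric.
have F0 : \bigcap_n (A `&` V n `&` X0) = set0.
  rewrite -subset0 => x h; have [[Ax _] _] := h 0%N I.
  move: oA; rewrite openE => /(_ x Ax) /nbhs_ballP[d /= d0 dA].
  have [[_ [z nAz]]] := h (Num.truncn d^-1) I.
  rewrite ballE => zx _; apply: nAz; apply: dA; rewrite ballE dist_sym.
  rewrite (lt_trans zx)// -[ltRHS]invrK ltf_pV2 ?posrE ?invr_gt0//.
  exact: truncnS_gt.
have [|||||n hn] := @shrinking_open (fun n => A `&` V n) 0%R e.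
- by move=> n; exact: openI.
- move=> m n mn; apply/subsetPset; apply: setIS => x [z nAz zx].
  exists z => //; apply: le_ball zx.
  by rewrite lef_pV2 ?posrE ?ltr0n// ler_nat.
- by rewrite F0; exact: measurable0.
- by rewrite F0 outer_measure0.
- exact: e0.
exists A, (V n); split => //.
by move=> x nAx; exists x => //; apply: ballxx; rewrite invr_gt0.
Qed.

(** The outer open sets of the pieces may be united, but an infinite
    intersection of the other ones need not be open: continuity from above
    allows to stop at a finite intersection. *)
Lemma approximable_bigcup (A : (set T)^nat) :
  (forall n, approximable X0 (A n)) -> approximable X0 (\bigcup_n A n).
Proof.
move=> hA e e0.
have e20 : (0 < e / 2)%R by rewrite divr_gt0.
have : forall n, exists UV : set T * set T, [/\ open UV.1, open UV.2,
    A n `<=` UV.1, ~` A n `<=` UV.2 &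
    mu (UV.1 `&` UV.2 `&` X0) <= (e / 2 / (2 ^ n.+1)%:R)%:E].
  move=> n; have [|U [V hUV]] := hA n (e / 2 / (2 ^ n.+1)%:R)%R.
    by rewrite divr_gt0// ltr0n expn_gt0.
  by exists (U, V).
move=> /choice[UV hUV].
pose U := \bigcup_n (UV n).1.
pose V n := \big[setI/setT]_(i < n) (UV i).2.
have oU : open U by apply: bigcup_open => n _; have [] := hUV n.
have oV n : open (V n).
  rewrite /V; elim/big_ind : _ => //; [exact: openT|exact: openI|].
  by move=> i _; have [] := hUV i.
have VE n : V n = \bigcap_(i < n) (UV i).2.
  by rewrite /V bigcap_mkord.
have FE : \bigcap_n (U `&` V n `&` X0) `<=`
    \bigcup_n ((UV n).1 `&` (UV n).2 `&` X0).
  move=> x h; have [[[n _ Unx] _] X0x] := h 0%N I.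
  exists n => //; split => //; split => //.
  by have [[_ +] _] := h n.+1 I; rewrite VE => /(_ n (ltnSn n)).
have mF : mu.-cara.-measurable (\bigcap_n (U `&` V n `&` X0)).
  apply: bigcapT_measurable => n; apply: (open_cara mms).
  by apply: openI => //; exact: openI.
have [|||||n hn] := @shrinking_open (fun n => U `&` V n) (e / 2)%R e.
- by move=> n; exact: openI.
- move=> m n mn; apply/subsetPset; apply: setIS; rewrite !VE => x h i /= im.
  by apply: h => /=; exact: leq_trans im mn.
- exact: mF.
- rewrite (le_trans (le_outer_measure mu _ _ FE))//.
  rewrite (le_trans (outer_measure_sigma_subadditive mu _))//.
  apply: le_trans (@epsilon_trick0 R _ xpredT (ltW e20)).
  apply: lee_nneseries => [i _ _|i _]; first exact: outer_measure_ge0.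
  by have [] := hUV i.
- by rewrite ltr_pdivrMr// ltr_pMr// ltr1n.
exists U, (V n); split => //.
- by move=> x [i _ Aix]; exists i => //; have [_ _ + _ _] := hUV i; apply.
- move=> x nAx; rewrite VE => i _; have [_ _ _ + _] := hUV i; apply.
  by move=> Aix; apply: nAx; exists i.
Qed.

Lemma borel_approximable (B : set T) :
  <<s [set U : set T | open U] >> B -> approximable X0 B.
Proof.
apply: smallest_sub; last by move=> A; exact: open_approximable.
split.
- move=> e e0; exists set0, setT; split => //; [exact: open0|exact: openT|].
  by rewrite !set0I outer_measure0 lee_fin ltW.
- move=> A hA e e0; have [U [V [oU oV AU AV le]]] := hA _ e0.
  exists V, U; rewrite setTD setCK; split => //.
  by rewrite (setIC V).
- by move=> A; exact: approximable_bigcup.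
Qed.

(** A measurable set of finite measure fills up its Borel hull except for a null
    set, which reduces the claim to Borel sets. *)
Lemma outer_regular (E : set T) (e : R) : mu.-cara.-measurable E ->
  E `<=` X0 -> (0 < e)%R ->
  exists U, [/\ open U, E `<=` U, U `<=` X0 & mu (U `\` E) <= e%:E].
Proof.
move=> mE EX0 e0; have [_ _ _ [_ /(_ E)[B [bB EB BE]]]] := mms.
have [U [V [oU oV BU BV UV]]] := borel_approximable bB e0.
exists (U `&` X0); split => //.
- exact: openI.
- by move=> x Ex; split; [exact/BU/EB|exact: EX0].
have fE : mu E \is a fin_num.
  rewrite ge0_fin_numE ?outer_measure_ge0//.
  by rewrite (le_lt_trans _ fX0)// le_outer_measure.
have BE0 : mu (B `\` E) = 0.
  have := mE B; rewrite (setIidr EB) BE -setDE.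
  move: fE; case: (mu E) => // x _; case: (mu (B `\` E)) => [r||]//= [] xr.
  by congr _%:E; lra.
have : U `&` X0 `\` E `<=` (U `&` V `&` X0) `|` (B `\` E).
  move=> x [[Ux X0x] nEx]; have [Bx|nBx] := pselect (B x); first by right.
  by left; split => //; split => //; exact: BV.
move=> /(le_outer_measure mu) /le_trans; apply.
by rewrite (le_trans (outer_measureU2 mu _ _))// BE0 adde0.
Qed.

End Regularity.

(** * A covering lemma for doubling measures *)

Section Covering.
Context (R : realType) (T : pmetricType R) (mu : {outer_measure set T -> \bar R}).
Context (mms : metric_measure_space mu).
Context (D : R) (D0 : 0 < D).
Context (dblD : forall (x : T) (r : R), 0 < r ->
  (mu (ball x (2 * r)) <= D%:E * mu (ball x r))%E).
Local Open Scope ereal_scope.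

Definition balls (s : seq (T * R)) := \bigcup_(p in [set` s]) ball p.1 p.2.

Lemma open_balls s : open (balls s).
Proof. by apply: bigcup_open => p _; exact: open_ball_metric. Qed.

Lemma max_radius (p : T * R) (s : seq (T * R)) : p \in s ->
  exists2 q, q \in s & forall r : T * R, r \in s -> (r.2 <= q.2)%R.
Proof.
move=> ps; have s0 : s != [::] by case: s ps.
elim: s {p ps} s0 => // p [|p' s] IH _.
  by exists p; rewrite ?mem_head// => r; rewrite inE => /eqP ->.
have [//|q qs qmax] := IH; have [pq|qp] := leP p.2 q.2.
  exists q; first by rewrite inE qs orbT.
  by move=> r; rewrite inE => /predU1P[->//|/qmax].
exists p; first by rewrite mem_head.
by move=> r; rewrite inE => /predU1P[->//|/qmax/le_trans -> //]; exact: ltW.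
Qed.

Context (nu : set T -> \bar R) (nu_ge0 : forall A, 0 <= nu A).
Hypothesis nu_mono :
  forall U V, open U -> open V -> U `<=` V -> nu U <= nu V.
Hypothesis nu_super : forall U V, open U -> open V -> U `&` V = set0 ->
  nu U + nu V <= nu (U `|` V).

(** Vitali's greedy argument, run as an induction that estimates the measure
    directly instead of extracting a disjoint subfamily: the balls that meet the
    largest one [B(p, r)] lie in [B(p, 4 * r)], whose measure doubling bounds,
    and [nu] adds up over [B(p, r)] and the balls that are disjoint from it. *)
Lemma vitali_balls (t : R) (s : seq (T * R)) : (0 < t)%R ->
  (forall p : T * R, p \in s -> (0 < p.2)%R /\
     t%:E * mu (ball p.1 p.2) <= nu (ball p.1 p.2)) ->
  t%:E * mu (balls s) <= (D ^+ 2)%:E * nu (balls s).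
Proof.
move=> t0; have [n] := ubnP (size s); elim: n s => // n IH s sn hs.
have D20 : (0 <= D ^+ 2)%R by rewrite exprn_ge0// ltW.
have [->|s0] := eqVneq s [::].
  rewrite /balls set_nil bigcup_set0 outer_measure0 mule0 mule_ge0//.
have [p0 p0s] : exists p, p \in s.
  by case: s s0 {sn hs} => // p s _; exists p; exact: mem_head.
have [p ps pmax] := max_radius p0s; have [p20 hp] := hs p ps.
pose a (q : T * R) := `[< ball q.1 q.2 `&` ball p.1 p.2 = set0 >].
pose s' := [seq q <- s | a q].
have s'n : (size s' < n)%N.
  rewrite (@leq_trans (size s))// size_filter ltn_neqAle count_size andbT.
  rewrite -all_count; apply/allPn; exists p => //.
  apply/negP => /asboolP; apply/eqP/set0P; exists p.1.
  by split; apply: ballxx.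
have s's q : q \in s' -> q \in s by rewrite mem_filter => /andP[].
have {IH} := IH s' s'n (fun q qs' => hs q (s's q qs')) => IH.
have cover : balls s `<=` ball p.1 (2 ^+ 2 * p.2) `|` balls s'.
  move=> x [q /= qs qx]; have [aq|/asboolPn/eqP/set0P[w]] := boolP (a q).
    by right; exists q => //=; rewrite mem_filter aq.
  rewrite /setI/= !ballE => -[qw pw]; left.
  suff h : (mdist p.1 q.1 + q.2 <= 2 ^+ 2 * p.2)%R.
    by have := subset_ball_dist h qx; rewrite ballE.
  have := dist_triangle p.1 w q.1; rewrite (dist_sym w).
  by have := pmax q qs; lra.
have disj : ball p.1 p.2 `&` balls s' = set0.
  rewrite -subset0 => x [px [q /=]]; rewrite mem_filter.
  move=> /andP[/asboolP aq _] qx.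
  by suff : (ball q.1 q.2 `&` ball p.1 p.2) x by rewrite aq.
have sub : ball p.1 p.2 `|` balls s' `<=` balls s.
  by move=> x [px|[q /= /s's qs qx]]; [exists p|exists q].
apply: (@le_trans _ _ (t%:E * (mu (ball p.1 (2 ^+ 2 * p.2)) + mu (balls s')))).
  rewrite lee_pmul2l ?lte_fin// (le_trans (le_outer_measure mu _ _ cover))//.
  exact: outer_measureU2.
rewrite ge0_muleDr ?outer_measure_ge0//.
apply: (@le_trans _ _ ((D ^+ 2)%:E * (nu (ball p.1 p.2) + nu (balls s')))).
  rewrite ge0_muleDr//; apply: leeD => //.
  apply: (@le_trans _ _ (t%:E * ((D ^+ 2)%:E * mu (ball p.1 p.2)))).
    by rewrite lee_pmul2l ?lte_fin//; exact: doubling_iter.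
  by rewrite muleCA lee_wpmul2l// lee_fin.
rewrite lee_wpmul2l ?lee_fin//.
apply: (le_trans (nu_super _ _ disj)).
- exact: open_ball_metric.
- exact: open_balls.
apply: nu_mono => //; [apply: openU|]; by [exact: open_ball_metric|exact: open_balls].
Qed.

(** Passage to countable families, by continuity from below. The bound is by
    [nu U], which the caller can make small. *)
Lemma vitali_countable (t : R) (U : set T) (B : nat -> option (T * R)) :
  (0 < t)%R -> open U ->
  (forall n p, B n = Some p -> [/\ (0 < p.2)%R, ball p.1 p.2 `<=` U &
     t%:E * mu (ball p.1 p.2) <= nu (ball p.1 p.2)]) ->
  t%:E * mu (\bigcup_n (if B n is Some p then ball p.1 p.2 else set0))
    <= (D ^+ 2)%:E * nu U.
Proof.
move=> t0 oU hB.
pose A i := if B i is Some p then ball p.1 p.2 else set0.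
rewrite -/(bigcup setT A).
pose S n := pmap B (iota 0 n).
have hS n p : p \in S n -> exists2 i, (i < n)%N & B i = Some p.
  rewrite mem_pmap => /mapP[i]; rewrite mem_iota add0n => /andP[_ iin] ->.
  by exists i.
have SE n : balls (S n) = \big[setU/set0]_(i < n) A i.
  rewrite -bigcup_mkord; apply/seteqP; split => [x [p /hS[i iin Bi] px]|x].
    by exists i => //; rewrite /A Bi.
  move=> [i /= iin]; rewrite /A; case Bi : (B i) => [p|//] px; exists p => //=.
  by rewrite mem_pmap; apply/mapP; exists i; rewrite ?mem_iota ?add0n.
have Sle n : t%:E * mu (balls (S n)) <= (D ^+ 2)%:E * nu U.
  apply: le_trans (vitali_balls (s := S n) t0 _) _.
    by move=> p /hS[i _ /hB[]].
  rewrite lee_wpmul2l ?lee_fin ?exprn_ge0 ?(ltW D0)//; apply: nu_mono => //.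
    exact: open_balls.
  by move=> x [p /hS[i _ /hB[_ + _]]]; apply.
have mA i : mu.-cara.-measurable (A i).
  rewrite /A; case: (B i) => [p|]; last exact: measurable0.
  exact: ball_cara.
rewrite -lee_pdivlMl//.
have mS n : mu.-cara.-measurable (balls (S n)).
  by apply: (open_cara mms); exact: open_balls.
have UE : \bigcup_n balls (S n) = \bigcup_n A n.
  apply/seteqP; split => [x [n _]|x [n _ Anx]].
    by rewrite SE -bigcup_mkord => -[i _ Aix]; exists i.
  by exists n.+1 => //; rewrite SE -bigcup_mkord; exists n => //=.
have cv : (cara_measure mu \o (fun n => balls (S n))) @ \oo -->
    cara_measure mu (\bigcup_n balls (S n)).
  apply: nondecreasing_cvg_mu; [exact: mS|exact: bigcupT_measurable|].
  by move=> m n mn; apply/subsetPset; rewrite !SE; exact: subset_bigsetU.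
rewrite -UE -(cvg_lim _ cv)//; apply: lime_le.
  by apply/cvg_ex; eexists; exact: cv.
by apply: nearW => n /=; rewrite lee_pdivlMl.
Qed.

End Covering.

(** * Mass near almost every point of a set *)

Section Differentiation.
Context (R : realType) (T : pmetricType R) (mu : {outer_measure set T -> \bar R}).
Context (mms : metric_measure_space mu).
Context (D : R) (D0 : 0 < D).
Context (dblD : forall (x : T) (r : R), 0 < r ->
  (mu (ball x (2 * r)) <= D%:E * mu (ball x r))%E).
Local Open Scope ereal_scope.
Local Notation m := (cara_measure mu).

Lemma outer_null_ae (P : T -> Prop) : mu (~` [set x | P x]) = 0 ->
  {ae m, forall x, P x}.
Proof.
move=> P0; exists (~` [set x | P x]); split => //.
apply: le_caratheodory_measurable => X.
have -> : mu (X `&` ~` [set x | P x]) = 0.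
  apply/eqP; rewrite eq_le outer_measure_ge0 andbT -P0.
  by apply: le_outer_measure; exact: subIsetr.
by rewrite add0e; apply: le_outer_measure; exact: subIsetl.
Qed.

Lemma ae_imply (P Q : T -> Prop) : (forall x, P x -> Q x) ->
  {ae m, forall x, P x} -> {ae m, forall x, Q x}.
Proof. by move=> PQ; apply: negligibleS => x; apply: contra_not; exact: PQ. Qed.

Lemma ae_and (P Q : T -> Prop) : {ae m, forall x, P x} ->
  {ae m, forall x, Q x} -> {ae m, forall x, P x /\ Q x}.
Proof.
move=> aP aQ; apply: negligibleS (negligibleU aP aQ) => x /= /not_andP[nP|nQ].
  by left.
by right.
Qed.

Lemma ae_forall_count (I : countType) (P : I -> T -> Prop) :
  (forall i, {ae m, forall x, P i x}) -> {ae m, forall x, forall i, P i x}.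
Proof.
move=> aP.
have /ae_foralln : forall n, \forall x \ae m,
    if unpickle n is Some i then P i x else True.
  by move=> n; case: unpickle => [i|]; [exact: aP|exact: aeW].
by apply: ae_imply => x h i; have := h (pickle i); rewrite pickleK.
Qed.

Lemma dense_sequence : exists e : nat -> T, forall x (r : R), (0 < r)%R ->
  exists n, (mdist x (e n) < r)%R.
Proof.
have [[A /pfcard_geP[A0|[e]] dA] _ _ _] := mms.
  have [||x [_]] := dA setT; [by exists point|exact: openT|].
  by rewrite A0.
exists e => x r r0.
have [||y [xy Ay]] := dA (ball x r).
- by exists x; exact: ballxx.
- exact: open_ball_metric.
have [n _ en] := @surj _ _ _ _ e y Ay.
by exists n; rewrite en -ballE.
Qed.

Section SmallDensity.
Context (h : T -> R) (h0 : forall x, (0 <= h x)%R).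
Hypothesis mh : measurable_fun ([set: T] : set (caratheodory_type mu)) h.
Hypothesis fh : forall x r, \int[m]_(y in ball x r) (h y)%:E < +oo.
Context (E : set T) (mE : mu.-cara.-measurable E).

Let nu (A : set T) := \int[m]_(y in A `\` E) (h y)%:E.

Let mhE (A : set T) :
  measurable_fun (A : set (caratheodory_type mu)) (fun x => (h x)%:E).
Proof. by apply/measurable_EFinP; apply: measurable_funS mh. Qed.

Let nu_ge0 A : 0 <= nu A.
Proof. by apply: integral_ge0 => x _; rewrite lee_fin. Qed.

Let nu_mono U V : open U -> open V -> U `<=` V -> nu U <= nu V.
Proof.
move=> oU oV UV; apply: ge0_subset_integral.
- by apply: measurableD => //; exact: (open_cara mms).
- by apply: measurableD => //; exact: (open_cara mms).
- exact: mhE.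
- by move=> x _; rewrite lee_fin.
- exact: setSD.
Qed.

Let nu_super U V : open U -> open V -> U `&` V = set0 ->
  nu U + nu V <= nu (U `|` V).
Proof.
move=> oU oV UV; rewrite /nu setDUl ge0_integral_setU//.
- by apply: measurableD => //; exact: (open_cara mms).
- by apply: measurableD => //; exact: (open_cara mms).
- by move=> x _; rewrite lee_fin.
- rewrite disj_set2E; apply/eqP; rewrite -subset0 => x [[Ux _] [Vx _]].
  by rewrite -UV.
Qed.

(** Outer regularity and absolute continuity of the integral: the density [h]
   restricted to the complement of [E] has little mass near [E]. *)
Let nu_open_small c N (eta : R) : (0 < eta)%R -> exists U,
  [/\ open U, E `&` ball c N `<=` U & nu U <= eta%:E].
Proof.
move=> eta0.
pose X0 := ball c N.
have oX0 : open X0 by exact: open_ball_metric.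
have mX0 : mu.-cara.-measurable X0 by exact: (open_cara mms).
have ih : m.-integrable setT (EFin \o (h \_ X0)).
  apply/integrableP; split.
    apply/measurable_EFinP/(measurable_restrictT _ _).1 => //.
    by apply: measurable_funS mh.
  rewrite [ltLHS](_ : _ = \int[m]_(y in X0) (h y)%:E); first exact: fh.
  rewrite [RHS]integral_mkcond; apply: eq_integral => x _ /=.
  by rewrite !patchE; case: ifP => _ /=; rewrite ?normr0// ger0_norm.
have [d [d0 hd]] := integral_normr_continuous ih eta0.
have d20 : (0 < d / 2)%R by rewrite divr_gt0.
have [|||U [oU EU UX0 Ud]] := @outer_regular _ _ mu mms X0 oX0
  (ball_fin mms D0 dblD c N) (E `&` X0) (d / 2)%R.
- by apply: measurableI.
- by move=> x [].
- exact: d20.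
exists U; split => //.
have mU : mu.-cara.-measurable U by exact: (open_cara mms).
have mUE : mu.-cara.-measurable (U `\` E) by exact: measurableD.
have UE : U `\` (E `&` X0) = U `\` E.
  apply/seteqP; split => x [Ux nE]; split => //.
    by move=> Ex; apply: nE; split => //; exact: UX0.
  by move=> [].
have := hd _ mUE; rewrite -UE => /(_ _)/wrap[].
  by rewrite (le_lt_trans Ud)// lte_fin ltr_pdivrMr// ltr_pMr// ltr1n.
rewrite UE /Rintegral => lt.
have nuE : nu U = \int[m]_(x in U `\` E) (`|(h \_ X0) x|)%:E.
  apply: eq_integral => x; rewrite inE => -[Ux _].
  by rewrite patchE mem_set ?ger0_norm//; exact: UX0.
rewrite nuE -[leLHS]fineK ?lee_fin ?ltW//.
rewrite -nuE ge0_fin_numE//; apply: le_lt_trans (fh c N).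
apply: ge0_subset_integral => //.
- by move=> x _; rewrite lee_fin.
- by move=> x [/UX0].
Qed.

(** Centers in a sequence and rational radii keep the family of balls countable,
   as the covering lemma requires. *)
Let bad (e : nat -> T) (t : R) (c : T) (N : R) := [set x | (E `&` ball c N) x /\
  forall d : R, (0 < d)%R -> exists i (q : rat), [/\ (0 < ratr q :> R)%R,
     (ratr q < d)%R, ball (e i) (ratr q) x &
     t%:E * mu (ball (e i) (ratr q)) <= nu (ball (e i) (ratr q))]].

(** The bad points of the bounded part [E `&` ball c N] are covered by balls
   inside an open set of [nu]-mass at most [eta], so the covering lemma bounds
   their measure by [D ^+ 2 * eta / t]; [eta] is chosen to make this [eps]. *)
Let bad_null e t c N : (0 < t)%R -> mu (bad e t c N) = 0.
Proof.
move=> t0; apply/eqP; rewrite eq_le outer_measure_ge0 andbT.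
apply/lee_addgt0Pr => eps eps0; rewrite add0e.
have D20 : (0 < D ^+ 2)%R by rewrite exprn_gt0.
pose eta := (eps * t / D ^+ 2)%R.
have [|U [oU EU nuU]] := @nu_open_small c N eta.
  by rewrite !divr_gt0 ?mulr_gt0.
pose B (n : nat) : option (T * R) :=
  if @unpickle (nat * rat)%type n is Some (i, q) then
  if `[< [/\ (0 < ratr q :> R)%R, ball (e i) (ratr q) `<=` U &
    t%:E * mu (ball (e i) (ratr q)) <= nu (ball (e i) (ratr q))] >]
  then Some (e i, ratr q) else None else None.
have hB n p : B n = Some p -> [/\ (0 < p.2)%R, ball p.1 p.2 `<=` U &
     t%:E * mu (ball p.1 p.2) <= nu (ball p.1 p.2)].
  rewrite /B; case: unpickle => [[i q]|//].
  by case: ifPn => // /asboolP hq [<-].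
have le := vitali_countable mms D0 dblD nu_ge0 nu_mono nu_super t0 oU hB.
have sub : bad e t c N `<=`
    \bigcup_n (if B n is Some p then ball p.1 p.2 else set0).
  move=> x [/EU Ux /= hx].
  move: oU; rewrite openE => /(_ x Ux) /nbhs_ballP[d /= d0 dU].
  have [|i [q [q0 qd qx tq]]] := hx (d / 2)%R; first by rewrite divr_gt0.
  exists (pickle (i, q)) => //; rewrite /B pickleK ifT//.
  apply/asboolP; split => //; apply: subset_trans dU.
  apply: subset_ball_dist; move: qx; rewrite ballE dist_sym => qx; lra.
rewrite -(@lee_pmul2l _ t%:E) ?lte_fin//.
apply: (@le_trans _ _ ((D ^+ 2)%:E * nu U)).
  by apply: le_trans le; rewrite lee_pmul2l ?lte_fin//; exact: le_outer_measure.
apply: (@le_trans _ _ ((D ^+ 2)%:E * eta%:E)).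
  by rewrite lee_pmul2l ?lte_fin.
by rewrite -!EFinM lee_fin /eta mulrC divfK ?gt_eqF// mulrC.
Qed.

(** The core of Lebesgue differentiation: almost every point of [E] sees little of
    the mass that [h] puts outside [E]. The balls need not be centered at the
    point, only close to it relative to their radius: this is how averages over
    the balls of a covering will meet the point. *)
Lemma ae_small_density : {ae m, forall x, E x ->
  forall eps : R, (0 < eps)%R -> exists2 d : R, (0 < d)%R &
    forall (z : T) (s : R), (0 < s < d)%R -> (mdist z x < 2 * s)%R ->
      \int[m]_(y in ball z s `\` E) (h y)%:E <= eps%:E * mu (ball z s)}.
Proof.
have [e de] := dense_sequence.
have : {ae m, forall x, forall NM : nat * nat,
    ~ bad e (NM.2.+1%:R^-1) point (NM.1%:R) x}.
  apply: ae_forall_count => -[N M] /=; apply: outer_null_ae.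
  rewrite [X in mu X](_ : _ = bad e (M.+1%:R^-1) point N%:R).
    by apply: bad_null; rewrite invr_gt0.
  by apply/seteqP; split => x /=; [exact: contrapT|move=> ? ?].
apply: ae_imply => x nbad Ex eps eps0.
have D30 : (0 < D ^+ 3)%R by rewrite exprn_gt0.
(* The threshold [1 / (M + 1)] absorbs the loss [D ^+ 3] of the passage from
   [ball z s] to a ball of the countable family. *)
pose M := Num.truncn (D ^+ 3 / eps).
have hM : (M.+1%:R^-1 * D ^+ 3 <= eps)%R.
  rewrite mulrC ler_pdivrMr// mulrC -ler_pdivrMr//.
  exact/ltW/truncnS_gt.
pose N := (Num.truncn (mdist point x)).+1.
have Nx : ball (point : T) N%:R x by rewrite ballE truncnS_gt.
have [d d0 hd] : exists2 d : R, (0 < d)%R & forall i (q : rat),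
    (0 < ratr q :> R)%R -> (ratr q < d)%R -> ball (e i) (ratr q) x ->
    nu (ball (e i) (ratr q)) <= M.+1%:R^-1%:E * mu (ball (e i) (ratr q)).
  apply: contrapT => nd; apply: (nbad (N, M)); split => // d d0.
  apply: contrapT => ni; apply: nd; exists d => // i q q0 qd qx.
  rewrite leNgt; apply/negP => lt; apply: ni; exists i, q; split => //.
  exact: ltW.
exists (d / 5)%R; first by rewrite divr_gt0.
move=> z s /andP[s0 sd] zx.
(* Since [x] is within [2 * s] of [z] and within [s] of [e i], a radius between
   [4 * s] and [5 * s] makes the ball around [e i] contain both [x] and
   [ball z s], and stay inside [ball z (8 * s)]. *)
have [i xei] := de x s s0.
have [q] := @rat_in_itvoo R (4 * s)%R (5 * s)%R ltac:(lra).
rewrite in_itv/= => /andP[q4 q5].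
have zei := dist_triangle z x (e i).
have eiz : mdist (e i) z = mdist z (e i) := dist_sym _ _.
have : ball z s `<=` ball (e i) (ratr q) by apply: subset_ball_dist; lra.
move=> /nu_mono -/(_ (open_ball_metric _ _) (open_ball_metric _ _)) /le_trans.
apply; apply: (le_trans (hd i q _ _ _)); [lra|lra| |].
  by rewrite ballE dist_sym; lra.
apply: (@le_trans _ _ (M.+1%:R^-1%:E * ((D ^+ 3)%:E * mu (ball z s)))).
  rewrite lee_wpmul2l ?lee_fin ?invr_ge0//.
  apply: (doubling_sub D0 dblD) => //; lra.
by rewrite muleA lee_wpmul2r ?outer_measure_ge0// -EFinM lee_fin.
Qed.

End SmallDensity.

End Differentiation.

(** * Density points and Lebesgue points *)

Section LebesguePoints.
Context (R : realType) (T : pmetricType R) (mu : {outer_measure set T -> \bar R}).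
Context (mms : metric_measure_space mu).
Context (D : R) (D0 : 0 < D).
Context (dblD : forall (x : T) (r : R), 0 < r ->
  (mu (ball x (2 * r)) <= D%:E * mu (ball x r))%E).
Local Notation m := (cara_measure mu).

(** Density zero at [x], for sets that need not be measurable: unlike the
    quotient in [density_point], this form is monotone and subadditive. *)
Definition negligible_at (A : set T) (x : T) := forall eps : R, 0 < eps ->
  exists2 d : R, 0 < d & forall r : R, 0 < r < d ->
    (mu (ball x r `&` A) <= eps%:E * mu (ball x r))%E.

Lemma negligible_atS (A B : set T) x :
  A `<=` B -> negligible_at B x -> negligible_at A x.
Proof.
move=> AB hB eps eps0; have [d d0 hd] := hB _ eps0; exists d => // r rd.
by apply: le_trans (hd r rd); apply: le_outer_measure; exact: setIS.
Qed.

Lemma negligible_atU (A B : set T) x :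
  negligible_at A x -> negligible_at B x -> negligible_at (A `|` B) x.
Proof.
move=> hA hB eps eps0; have e2 : 0 < eps / 2 by rewrite divr_gt0.
have [d1 d10 h1] := hA _ e2; have [d2 d20 h2] := hB _ e2.
exists (Num.min d1 d2); first by rewrite lt_min d10.
move=> r /andP[r0]; rewrite lt_min => /andP[rd1 rd2].
rewrite setIUr (le_trans (outer_measureU2 mu _ _))//.
rewrite [eps in leRHS]splitr EFinD ge0_muleDl ?lee_fin ?(ltW e2)//.
by apply: leeD; [apply: h1|apply: h2]; rewrite r0.
Qed.

Lemma density_pointP (A : set T) (x : T) : mu.-cara.-measurable A ->
  density_point mu A x <-> negligible_at (~` A) x.
Proof.
move=> mA.
have key r e : 0 < r ->
    (`|1 - fine (mu (ball x r `&` A)) / fine (mu (ball x r))| <= e) =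
    (mu (ball x r `&` ~` A) <= e%:E * mu (ball x r))%E.
  move=> r0; have b0 := fine_ball_gt0 mms D0 dblD x r0.
  have fI (S : set T) : mu (ball x r `&` S) \is a fin_num.
    rewrite ge0_fin_numE ?outer_measure_ge0//.
    apply: le_lt_trans (ball_fin mms D0 dblD x r).
    by apply: le_outer_measure; exact: subIsetl.
  have E : fine (mu (ball x r)) =
      fine (mu (ball x r `&` A)) + fine (mu (ball x r `&` ~` A)).
    by rewrite -fineD//; congr fine; exact: mA.
  have c0 : 0 <= fine (mu (ball x r `&` ~` A))
    by rewrite fine_ge0// outer_measure_ge0.
  rewrite -[X in _ = (X <= _)%E](fineK (fI (~` A))).
  rewrite -[X in _ = (_ <= _ * X)%E](ball_fineK mms D0 dblD) -EFinM lee_fin.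
  move: b0 E c0 => {fI}.
  move: (fine _) (fine _) (fine _) => c a b b0 E c0.
  have -> : 1 - a / b = c / b.
    by rewrite -[1](@divff _ b) ?gt_eqF// -mulrBl E [a + c]addrC addrK.
  by rewrite ger0_norm ?divr_ge0 ?(ltW b0)// ler_pdivrMr.
split=> [[_ cv] eps eps0|hA].
  move/cvgrPdist_lt : cv => /(_ eps eps0) [d /= d0 hd].
  exists d => // r /andP[r0 rd]; rewrite -key//; apply/ltW/hd => //=.
  by change (`|0 - r| < d :> R); rewrite distrC subr0 gtr0_norm.
split => //; apply/cvgrPdist_le => eps eps0.
have [d d0 hd] := hA _ eps0; exists d => //= r rd r0.
rewrite key//; apply: hd; rewrite r0/=.
by move: rd; change (`|0 - r| < d -> r < d :> R); rewrite distrC subr0 gtr0_norm.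
Qed.

(** Lebesgue's density theorem: the case of a constant density. *)
Lemma ae_density (E : set T) : mu.-cara.-measurable E ->
  {ae m, forall x, E x -> negligible_at (~` E) x}.
Proof.
move=> mE.
have int1 (A : set T) : mu.-cara.-measurable A ->
    (\int[m]_(y in A) 1%:E)%E = mu A.
  move=> mA; rewrite -[LHS]/(\int[m]_(y in A) cst 1%:E y)%E.
  by rewrite integral_cst// mul1e.
have fin1 (x : T) (r : R) : (\int[m]_(y in ball x r) 1%:E < +oo)%E.
  by rewrite int1; [exact: (ball_fin mms D0 dblD)|exact: ball_cara].
have := ae_small_density mms D0 dblD (fun=> ler01) (measurable_cst _) fin1 mE.
apply: ae_imply => x h Ex eps eps0; have [d d0 hd] := h Ex eps eps0.
exists d => // r rd; have r0 : 0 < r by case/andP: rd.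
have := hd x r rd; rewrite mdistxx int1; first by apply; rewrite mulr_gt0.
by apply: measurableD => //; exact: ball_cara.
Qed.

(** Near almost every point of the slice of [g] at height [q] and width
    [1 / (k + 1)], the average of [|g - q|] is small: on the slice by definition,
    and off the slice because little mass is there. Countably many slices suffice,
    and some slice of each width contains the given point. *)
Lemma ae_lebesgue_point (g : T -> R) : integrable_fun mu g ->
  {ae m, forall x, forall eps : R, 0 < eps -> exists2 d : R, 0 < d &
    forall (z : T) (s : R), 0 < s < d -> mdist z x < 2 * s ->
      `|average mu g (ball z s) - g x| <= eps}.
Proof.
move=> ig.
have mg : measurable_fun ([set: T] : set (caratheodory_type mu)) g.
  by apply/measurable_EFinP; case/integrableP: ig.
have ic (q : R) z s : m.-integrable (ball z s) (EFin \o (fun=> q)).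
  apply: measurable_bounded_integrable => //.
  - exact: ball_cara.
  - exact: (ball_fin mms D0 dblD).
  - exists `|q|; split; first exact: num_real.
    by move=> M /ltW qM x _.
have igb z s : m.-integrable (ball z s) (EFin \o g).
  by apply: integrableS ig => //; exact: ball_cara.
have id (q : R) z s : m.-integrable (ball z s) (EFin \o (fun y => g y - q)).
  have := integrableB (ball_cara mms z s) (igb z s) (ic q z s).
  by apply: eq_integrable => //; exact: ball_cara.
pose h (q : rat) := fun y => `|g y - ratr q|.
have mh q : measurable_fun ([set: T] : set (caratheodory_type mu)) (h q).
  apply: measurableT_comp => //.
  by apply: measurable_funB => //; exact: measurable_cst.
pose E (p : rat * nat) := [set y | h p.1 y <= p.2.+1%:R^-1].
have mE p : mu.-cara.-measurable (E p).
  rewrite -[E p]setTI; apply: measurable_fun_le => //; exact: mh.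
have : {ae m, forall x, forall p : rat * nat, E p x ->
    forall eps : R, 0 < eps -> exists2 d : R, 0 < d &
    forall (z : T) (s : R), 0 < s < d -> mdist z x < 2 * s ->
      (\int[m]_(y in ball z s `\` E p) (h p.1 y)%:E <= eps%:E * mu (ball z s))%E}.
  apply: ae_forall_count => p.
  apply: (ae_small_density mms D0 dblD _ (mh p.1) _ (mE p)) => [y|z s].
    exact: normr_ge0.
  by have /integrableP[_] := id (ratr p.1) z s.
apply: ae_imply => x hx eps eps0.
pose k := Num.truncn (4 / eps).
have hk : k.+1%:R^-1 <= eps / 4.
  rewrite -[leRHS]invrK lef_pV2 ?posrE ?invr_gt0 ?divr_gt0// invf_div.
  exact/ltW/truncnS_gt.
have k0 : 0 < k.+1%:R^-1 :> R by rewrite invr_gt0.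
have [|q] := @rat_in_itvoo R (g x - k.+1%:R^-1) (g x + k.+1%:R^-1) _.
  by rewrite ltrBlDr -addrA ltrDl addr_gt0.
rewrite in_itv/= => /andP[q1 q2].
have gq : `|g x - ratr q| <= k.+1%:R^-1.
  by rewrite distrC ler_distl !ltW.
have [|d d0 hd] := hx (q, k) gq (eps / 4); first by rewrite divr_gt0.
exists d => // z s sd zx; have s0 : 0 < s by case/andP: sd.
have {hd zx sd} := hd z s sd zx; set B := ball z s => hd.
have mB : mu.-cara.-measurable B by exact: ball_cara.
have b0 : 0 < fine (mu B) := fine_ball_gt0 mms D0 dblD z s0.
have bE : (fine (mu B))%:E = mu B := ball_fineK mms D0 dblD z s.
have avE : average mu g B - ratr q =
    (fine (mu B))^-1 * \int[m]_(y in B) (g y - ratr q).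
  have -> : \int[m]_(y in B) (g y - ratr q) =
      \int[m]_(y in B) g y - ratr q * fine (mu B).
    rewrite -[in RHS](@Rintegral_cst _ _ _ m B mB).
    by rewrite -(RintegralB mB (igb z s) (ic (ratr q) z s)).
  rewrite /average mulrBr; congr (_ - _).
  by rewrite mulrCA mulVf ?mulr1// gt_eqF.
have intle : \int[m]_(y in B) `|g y - ratr q| <= eps / 2 * fine (mu B).
  have mEB : mu.-cara.-measurable (B `&` E (q, k)) by exact: measurableI.
  have mEC : mu.-cara.-measurable (B `\` E (q, k)) by exact: measurableD.
  have mhq (A : set T) :
      measurable_fun (A : set (caratheodory_type mu)) (fun y => (h q y)%:E).
    by apply/measurable_EFinP; apply: measurable_funS (mh q).
  rewrite -lee_fin /Rintegral fineK; last first.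
    rewrite ge0_fin_numE; first by have /integrableP[_] := id (ratr q) z s.
    by apply: integral_ge0 => y _; rewrite lee_fin.
  rewrite -{1}(setUIDK B (E (q, k))) ge0_integral_setU//; last first.
    rewrite disj_set2E; apply/eqP; rewrite -subset0 => y [[_ Ey] [_ nEy]].
    exact: nEy.
  rewrite [eps / 2](_ : _ = eps / 4 + eps / 4); last by lra.
  rewrite mulrDl EFinD; apply: leeD; last by rewrite EFinM bE.
  apply: (@le_trans _ _ (\int[m]_(y in B `&` E (q, k)) (eps / 4)%:E)%E).
    apply: ge0_le_integral => // y [_ Ey].
    by rewrite lee_fin (le_trans Ey).
  rewrite -[X in (X <= _)%E]/(\int[m]_(y in B `&` E (q, k)) cst (eps / 4)%:E y)%E.
  rewrite integral_cst// [leRHS]EFinM bE.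
  rewrite lee_wpmul2l ?lee_fin ?divr_ge0 ?(ltW eps0)//.
  by apply: le_outer_measure; exact: subIsetl.
have : `|average mu g B - ratr q| <= eps / 2.
  rewrite avE normrM gtr0_norm ?invr_gt0// mulrC ler_pdivrMr//.
  by apply: le_trans intle; exact: (le_normr_Rintegral mB (id (ratr q) z s)).
move=> avq; apply: le_trans (ler_distD (ratr q) _ _) _.
by rewrite (distrC (ratr q)); have := le_trans gq hk; lra.
Qed.

End LebesguePoints.

(** * Locality of approximate derivatives *)

Section ApproximateDerivatives.
Context (R : realType) (T : pmetricType R) (mu : {outer_measure set T -> \bar R}).
Context (mms : metric_measure_space mu).
Context (D : R) (D0 : 0 < D).
Context (dblD : forall (x : T) (r : R), 0 < r ->
  (mu (ball x (2 * r)) <= D%:E * mu (ball x r))%E).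
Local Notation m := (cara_measure mu).

Lemma measurable_lipschitz (g : T -> R) (K : R) :
  (forall x y, `|g x - g y| <= K * mdist x y) ->
  measurable_fun ([set: T] : set (caratheodory_type mu)) g.
Proof.
move=> gK _; apply: (measurability _ (RGenOInfty.measurableE R)) => //.
move=> _ [_ [a ->] <-]; rewrite setTI; apply: (open_cara mms).
rewrite openE => x /=; rewrite in_itv/= andbT => ax.
have K0 : 0 < `|K| + 1 by rewrite ltr_wpDl.
apply/nbhs_ballP; exists ((g x - a) / (`|K| + 1)).
  by rewrite /= divr_gt0// subr_gt0.
move=> y; rewrite ballE ltr_pdivlMr// => xy; rewrite /= in_itv/= andbT.
have := gK x y; rewrite ler_norml => /andP[_ h].
have d0 : 0 <= mdist x y by exact: mdist_ge0.
have hK : K * mdist x y <= `|K| * mdist x y by rewrite ler_wpM2r// ler_norm.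
nra.
Qed.

Lemma dist_lipschitz (x y z : T) : `|mdist x y - mdist x z| <= 1 * mdist y z.
Proof.
have h1 := dist_triangle x y z; have h2 := dist_triangle x z y.
by rewrite mul1r ler_norml; rewrite (dist_sym z) in h2; apply/andP; split; lra.
Qed.

Lemma measurable_inv_dist (x : T) :
  measurable_fun ([set: T] : set (caratheodory_type mu))
    (fun y => (mdist x y)^-1).
Proof.
have md : measurable_fun ([set: T] : set (caratheodory_type mu)) (mdist x).
  exact: measurable_lipschitz (dist_lipschitz x).
move=> _; apply: (measurability _ (RGenOInfty.measurableE R)) => //.
move=> _ [_ [a ->] <-]; rewrite setTI.
have [a0|a0] := ltP a 0.
  rewrite [X in measurable X](_ : _ = setT)//; apply/seteqP; split => // y _ /=.
  by rewrite in_itv/= andbT (lt_le_trans a0)// invr_ge0 mdist_ge0.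
(* The inverse of zero is zero, so at [x] itself the value is not above [a]. *)
rewrite [X in measurable X](_ : _ =
    [set y | 0 < mdist x y] `&` [set y | a * mdist x y < 1]).
  have mlt (f g : T -> R) :
      measurable_fun ([set: T] : set (caratheodory_type mu)) f ->
      measurable_fun ([set: T] : set (caratheodory_type mu)) g ->
      mu.-cara.-measurable [set y | f y < g y].
    move=> mf mg; rewrite (_ : [set y | f y < g y] =
      ~` (setT `&` [set y | g y <= f y])).
      by apply: measurableC; exact: measurable_fun_le.
    by rewrite setTI; apply/seteqP; split => y /=; rewrite ltNge => /negP.
  apply: measurableI; apply: mlt => //.
  by apply: measurable_funM => //; exact: measurable_cst.
apply/seteqP; split => y /=; rewrite in_itv/= andbT.
  move=> h; have d0 : 0 < mdist x y by rewrite -invr_gt0 (le_lt_trans a0).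
  by split => //; rewrite -ltr_pdivlMr// div1r.
by move=> [d0 h]; rewrite -[_^-1]div1r ltr_pdivlMr.
Qed.

Section Chart.
Context (n : nat) (X : T -> 'rV[R]_n) (XL : lipschitz_map X).

Lemma measurable_coord (i : 'I_n) :
  measurable_fun ([set: T] : set (caratheodory_type mu)) (fun y => X y 0 i).
Proof.
have [K hK] := XL; apply: (@measurable_lipschitz _ K) => x y.
apply: le_trans (hK x y).
have -> : X x 0 i - X y 0 i = (X x - X y) 0 i by rewrite !mxE.
rewrite /Num.norm/= mx_normrE.
exact: (le_bigmax _ (fun ij => `|(X x - X y) ij.1 ij.2|) (0, i)).
Qed.

Lemma measurable_difference_quotient (F : T -> \bar R) (x : T) (v : 'rV[R]_n) :
  measurable_fun ([set: T] : set (caratheodory_type mu)) F ->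
  measurable_fun ([set: T] : set (caratheodory_type mu)) (fun y =>
    `|F y - F x - (\sum_(i < n) v 0 i * (X y 0 i - X x 0 i))%:E|
              * ((mdist x y)^-1)%:E)%E.
Proof.
move=> mF; apply: emeasurable_funM; last first.
  by apply/measurable_EFinP; exact: measurable_inv_dist.
apply: measurableT_comp => //; apply: emeasurable_funB.
  by apply: emeasurable_funB => //; exact: measurable_cst.
apply/measurable_EFinP; apply: measurable_sum => i.
apply: measurable_funM; first exact: measurable_cst.
by apply: measurable_funB; [exact: measurable_coord|exact: measurable_cst].
Qed.

(** Approximate derivatives only depend on the function up to a set of density
    zero at the point. *)
Lemma approx_derivative_congr (F : T -> \bar R) (G : T -> R) (x : T)
    (v : 'rV[R]_n) :
  measurable_fun ([set: T] : set (caratheodory_type mu)) F ->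
  F x = (G x)%:E -> negligible_at mu (~` [set y | F y = (G y)%:E]) x ->
  approx_derivative mu X (EFin \o G) x v -> approx_derivative mu X F x v.
Proof.
move=> mF Fx nA [_ GX]; split; first by rewrite Fx.
move=> e e0; have /= [mG dG] := GX e e0.
apply/(density_pointP mms D0 dblD).
  rewrite -[X in measurable X]setTI; apply: emeasurable_fun_infty_o => //.
  apply: measurableT_comp => //; apply: emeasurable_funD; last exact: measurable_cst.
  exact: measurable_difference_quotient.
have /(density_pointP mms D0 dblD) := conj mG dG => /(_ mG) dG'.
apply: negligible_atS (negligible_atU nA dG') => y nF.
have [Fy|nFy] := pselect (F y = (G y)%:E); last by left.
by right => Gy; apply: nF; rewrite /= Fx Fy.
Qed.

Lemma approx_derivativeN (f : T -> R) (x : T) (v : 'rV[R]_n) :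
  approx_derivative mu X (EFin \o f) x v ->
  approx_derivative mu X (EFin \o (fun y => - f y)) x (- v).
Proof.
move=> [_ h]; split => //; move: h; congr (ap_lim mu _ x 0).
apply/funext => y /=; congr (_ * _)%E; congr (_%:E).
under [in RHS]eq_bigr do rewrite mxE mulNr.
by rewrite sumrN -[LHS]normrN; congr (`|_|); ring.
Qed.

End Chart.

Section Structure.
Context (Lam : countType) (N : Lam -> nat) (Xs : Lam -> set T).
Context (xs : forall a : Lam, T -> 'rV[R]_(N a)).
Context (ads : approx_diff_structure Xs xs mu).

Lemma lipschitz_approx_differentiable (g : T -> R) (K : R) :
  (forall x y, `|g x - g y| <= K * mdist x y) ->
  approx_differentiable_ae Xs xs mu (EFin \o g).
Proof.
move=> gK; have [_ _ _ _ hL] := ads; apply: ae_forall_count => a.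
have [|dg [[_ _ hg] _]] := hL g _ a; first by exists K.
by apply: ae_imply hg => x h Xx; exists (dg x); exact: h.
Qed.

(** Almost every point of the set where [F] agrees with [G i] is one of its
    density points, so [F] inherits the approximate derivative of [G i]
    there. *)
Lemma approx_differentiable_piecewise (F : T -> \bar R) (I : countType)
    (G : I -> T -> R) :
  measurable_fun ([set: T] : set (caratheodory_type mu)) F ->
  (forall i, measurable_fun ([set: T] : set (caratheodory_type mu)) (G i)) ->
  (forall i, approx_differentiable_ae Xs xs mu (EFin \o G i)) ->
  {ae m, forall x, exists i, F x = (G i x)%:E} ->
  approx_differentiable_ae Xs xs mu F.
Proof.
move=> mF mG dG cov; have [_ xsL _ _ _] := ads.
pose A i := [set y | F y = (G i y)%:E].
have mA i : mu.-cara.-measurable (A i).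
  rewrite -[A i]setTI; apply: measurable_eqe => //.
  by apply/measurable_EFinP; exact: mG.
have dA := ae_forall_count (fun i => ae_density mms D0 dblD (mA i)).
have := ae_and cov (ae_and dA (ae_forall_count dG)).
apply: ae_imply => x [[i Fx] [dAx dGx]] a Xax.
have [v hv] := dGx i a Xax; exists v.
exact: approx_derivative_congr mF Fx (dAx i Fx) hv.
Qed.

End Structure.
End ApproximateDerivatives.

(** * Discrete convolution at one scale *)

Section OneScale.
Context (R : realType) (T : pmetricType R) (mu : {outer_measure set T -> \bar R}).
Context (mms : metric_measure_space mu).
Context (D : R) (D0 : 0 < D).
Context (dblD : forall (x : T) (r : R), 0 < r ->
  (mu (ball x (2 * r)) <= D%:E * mu (ball x r))%E).
Local Notation m := (cara_measure mu).
Context (g : T -> R) (g0 : forall x, 0 <= g x) (ig : integrable_fun mu g).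
Context (C L r : R) (r0 : 0 < r) (P : ball_partition T).
Context (admP : admissible_partition C L r P).

Local Notation I := (bp_index P).
Local Notation psi := (bp_fun P).
Local Notation c := (bp_center P).
Let a i := average mu g (ball (c i) (3 * r)).
Local Notation h := (discrete_convolution mu P r g).

Lemma average_ge0 A : 0 <= average mu g A.
Proof.
apply: mulr_ge0; first by rewrite invr_ge0 fine_ge0// outer_measure_ge0.
by apply: Rintegral_ge0.
Qed.

Let psi_ge0 i x : I i -> 0 <= psi i x.
Proof. by move=> Ii; have [_ _ /(_ i Ii)[/(_ x)/andP[]]] := admP. Qed.

Let psi_supp i x : I i -> psi i x != 0 -> mdist (c i) x < 6 * r.
Proof.
move=> Ii px; have [_ _ /(_ i Ii)[_ + _ _] _] := admP; rewrite -ballE; apply.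
exact: subset_closure.
Qed.

Let psi_sum x : (\sum_(0 <= i <oo | i \in I) (psi i x)%:E)%E = 1%:E.
Proof. by have [_ _ _ ->] := admP. Qed.

Lemma convolution_ge0 x : (0 <= h x)%E.
Proof.
apply: nneseries_ge0 => i _; rewrite inE => Ii.
by rewrite lee_fin mulr_ge0 ?average_ge0 ?psi_ge0.
Qed.

Lemma measurable_convolution :
  measurable_fun ([set: T] : set (caratheodory_type mu)) h.
Proof.
apply: ge0_emeasurable_sum => [i x _|i]; rewrite inE => Ii.
  by rewrite lee_fin mulr_ge0 ?average_ge0 ?psi_ge0.
apply/measurable_EFinP; apply: measurable_funM; last exact: measurable_cst.
have [_ _ /(_ i Ii)[_ _ _ hL] _] := admP.
exact: (measurable_lipschitz mms hL).
Qed.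

(** A discrete convolution is a weighted mean of averages. *)
Lemma convolution_near (x : T) (e : R) : 0 <= e ->
  (forall i, I i -> psi i x != 0 -> `|a i - g x| <= e) ->
  (h x <= (g x + e)%:E)%E /\ ((g x)%:E <= h x + e%:E)%E.
Proof.
move=> e0 hx.
have cst (k : R) : 0 <= k ->
    (\sum_(0 <= i <oo | i \in I) (k%:E * (psi i x)%:E))%E = k%:E.
  move=> k0; rewrite nneseriesZl; first by rewrite psi_sum mule1.
  by move=> i; rewrite inE => Ii; rewrite lee_fin psi_ge0.
have aux i : I i -> psi i x * a i <= (g x + e) * psi i x /\
    g x * psi i x <= psi i x * a i + e * psi i x.
  move=> Ii; have p0 := psi_ge0 x Ii; have [->|px] := eqVneq (psi i x) 0.
    by rewrite !mulr0 !mul0r addr0.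
  have := hx i Ii px; rewrite ler_distl => /andP[h1 h2]; split; nra.
split.
  rewrite -cst ?addr_ge0//; apply: lee_nneseries => i.
    by rewrite inE => _ Ii; rewrite lee_fin mulr_ge0 ?average_ge0 ?psi_ge0.
  by rewrite inE => Ii; rewrite -EFinM lee_fin; have [] := aux i Ii.
rewrite -[X in (X <= _)%E](cst _ (g0 x)) -[X in (_ + X)%E](cst _ e0).
rewrite -nneseriesD; last 2 first.
- by move=> i _; rewrite inE => Ii; rewrite lee_fin mulr_ge0 ?average_ge0 ?psi_ge0.
- by move=> i _; rewrite inE => Ii; rewrite -EFinM lee_fin mulr_ge0 ?psi_ge0.
apply: lee_nneseries => i.
  by rewrite inE => _ Ii; rewrite -EFinM lee_fin mulr_ge0 ?psi_ge0.
by rewrite inE => Ii; rewrite -!EFinM -EFinD lee_fin; have [] := aux i Ii.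
Qed.

Section Localized.
Context (x0 : T) (s : R) (s0 : 0 < s) (sr : s <= r).

(** Bound for the averages of [g] over the balls that matter at points of
    [ball x0 s]; it does not depend on the scale [r >= s]. *)
Definition convolution_bound :=
  D ^+ 2 * (\int[m]_y g y) / fine (mu (ball x0 s)).
Local Notation A := convolution_bound.

Lemma convolution_bound_ge0 : 0 <= A.
Proof.
rewrite divr_ge0 ?mulr_ge0 ?exprn_ge0 ?(ltW D0)//.
  by apply: Rintegral_ge0.
by rewrite fine_ge0// outer_measure_ge0.
Qed.

Let average_le i x : mdist x0 x < s -> mdist (c i) x < 6 * r -> a i <= A.
Proof.
move=> xs cx; set B := ball (c i) (3 * r).
have r30 : 0 < 3 * r by rewrite mulr_gt0.
have b0 : 0 < fine (mu B) := fine_ball_gt0 mms D0 dblD (c i) r30.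
have m0 := fine_ball_gt0 mms D0 dblD x0 s0.
have mB : mu.-cara.-measurable B by exact: ball_cara.
have iB : m.-integrable B (EFin \o g) by apply: integrableS ig.
have N0 : 0 <= \int[m]_y g y by apply: Rintegral_ge0.
have le1 : \int[m]_(y in B) g y <= \int[m]_y g y.
  rewrite fine_le//.
  - exact: integrable_fin_num iB.
  - exact: integrable_fin_num ig.
  apply: ge0_subset_integral => //.
  - by have /integrableP[] := ig.
  - by move=> y _; rewrite lee_fin.
have le2 : fine (mu (ball x0 s)) <= D ^+ 2 * fine (mu B).
  rewrite -lee_fin EFinM !(ball_fineK mms D0 dblD).
  apply: (doubling_sub D0 dblD) => //.
  have := dist_triangle (c i) x x0; rewrite (dist_sym x); move: sr; lra.
rewrite /a /average -/B mulrC ler_pdivrMr//.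
rewrite /convolution_bound [leRHS]mulrAC ler_pdivlMr//.
have D20 : 0 <= D ^+ 2 by rewrite exprn_ge0// ltW.
apply: (@le_trans _ _ ((\int[m]_y g y) * (D ^+ 2 * fine (mu B)))).
  by apply: ler_pM => //; [apply: Rintegral_ge0 => //|exact: ltW].
by rewrite le_eqVlt; apply/orP; left; apply/eqP; ring.
Qed.

(** The balls [B(c i, r / 2)] with [psi i x != 0] are disjoint, lie in
   [B(x, 7 * r)] and fill a definite fraction of it each, which limits their
   number. The count is made by summing measures, as the family is not yet known
   to be finite. *)
Let overlap x :
  (\sum_(0 <= i <oo | (i \in I) && (psi i x != 0)%R) 1 <= (D ^+ 5)%:E)%E.
Proof.
have r70 : 0 < 7 * r by rewrite mulr_gt0.
set M := fine (mu (ball x (7 * r))).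
have M0 : 0 < M := fine_ball_gt0 mms D0 dblD x r70.
have D50 : 0 < D ^+ 5 by rewrite exprn_gt0.
pose J := [set i | I i /\ psi i x != 0].
have JE i : ((i \in I) && (psi i x != 0)) = (i \in J).
  apply/andP/idP => [[/set_mem Ii px]|/set_mem[Ii px]].
    exact/mem_set.
  by split => //; exact/mem_set.
apply: (@le_trans _ _ (\sum_(0 <= i <oo | i \in J)
    ((D ^+ 5 / M)%:E * mu (ball (c i) (r / 2))))%E).
  under eq_eseriesl do rewrite JE.
  apply: lee_nneseries => // i; rewrite inE => -[Ii px].
  rewrite -(@lee_pmul2l _ M%:E) ?lte_fin// mule1 muleA -EFinM.
  rewrite [M * _]mulrC divfK ?gt_eqF// (ball_fineK mms D0 dblD).
  apply: (doubling_sub D0 dblD); first by rewrite divr_gt0.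
  by have := psi_supp Ii px; move: r0; lra.
rewrite nneseriesZl; last by move=> i _; exact: outer_measure_ge0.
have -> : (\sum_(0 <= i <oo | i \in J) mu (ball (c i) (r / 2)))%E =
    mu (\bigcup_(i in J) ball (c i) (r / 2)).
  rewrite -[RHS]/(m _) measure_bigcup//.
    by move=> i _; exact: ball_cara.
  have [_ tI _ _] := admP.
  by apply: sub_trivIset tI => i [].
apply: (@le_trans _ _ ((D ^+ 5 / M)%:E * mu (ball x (7 * r)))%E).
  rewrite lee_wpmul2l ?lee_fin ?divr_ge0 ?(ltW D50) ?(ltW M0)//.
  apply: le_outer_measure => y [i [Ii px]]; apply: subset_ball_dist.
  by have := psi_supp Ii px; rewrite dist_sym; move: r0; lra.
by rewrite -(ball_fineK mms D0 dblD) -EFinM lee_fin divfK// gt_eqF.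
Qed.

Lemma convolution_le x : mdist x0 x < s -> (h x <= A%:E)%E.
Proof.
move=> xs; rewrite -[leRHS]mule1 -(psi_sum x) -nneseriesZl; last first.
  by move=> i; rewrite inE => Ii; rewrite lee_fin psi_ge0.
apply: lee_nneseries => i.
  by rewrite inE => _ Ii; rewrite lee_fin mulr_ge0 ?average_ge0 ?psi_ge0.
rewrite inE => Ii; rewrite -EFinM lee_fin mulrC.
have [->|px] := eqVneq (psi i x) 0; first by rewrite !mulr0.
by rewrite ler_wpM2r ?psi_ge0//; apply: average_le xs _; exact: psi_supp.
Qed.

(** Lipschitz constant of the weights, times the bound of the averages, times the
    number of overlapping balls. *)
Definition convolution_lip := `|L| / s * A * D ^+ 5.

(** Only the indices with [psi i x != 0] can increase the sum, so it suffices to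
    control the overlap at [x], which is close to [x0]; [y] may be arbitrary. *)
Lemma convolution_lipschitz x y : mdist x0 x < s ->
  (h x <= h y + (convolution_lip * mdist x y)%:E)%E.
Proof.
move=> xs; have A0 := convolution_bound_ge0.
pose k := `|L| / s * A * mdist x y.
have Ls0 : 0 <= `|L| / s by rewrite divr_ge0// ltW.
have k0 : 0 <= k by apply: mulr_ge0 (mdist_ge0 _ _); exact: mulr_ge0.
apply: (@le_trans _ _ (h y +
    \sum_(0 <= i <oo | i \in I) (if (psi i x != 0)%R then k%:E * 1 else 0))%E).
  rewrite -nneseriesD; last 2 first.
  - by move=> i _; rewrite inE => Ii; rewrite lee_fin mulr_ge0 ?average_ge0 ?psi_ge0.
  - by move=> i _ _; case: ifPn => // _; rewrite mule1 lee_fin.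
  apply: lee_nneseries => i.
    by rewrite inE => _ Ii; rewrite lee_fin mulr_ge0 ?average_ge0 ?psi_ge0.
  rewrite inE => Ii; case: ifPn => [px|/negPn/eqP ->]; last first.
    by rewrite mul0r adde0 lee_fin mulr_ge0 ?average_ge0 ?psi_ge0.
  rewrite mule1 -EFinD lee_fin -lerBlDl -mulrBl.
  have [_ _ /(_ i Ii)[_ _ _ /(_ x y) hL] _] := admP.
  have aA : a i <= A by apply: average_le xs _; exact: psi_supp.
  have a0 : 0 <= a i by exact: average_ge0.
  have d0 : 0 <= mdist x y by exact: mdist_ge0.
  have LL : L / r * mdist x y <= `|L| / s * mdist x y.
    rewrite ler_wpM2r// (@le_trans _ _ (`|L| / r))//.
      by rewrite ler_wpM2r ?invr_ge0 ?ler_norm// ltW.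
    by rewrite ler_wpM2l// lef_pV2.
  have le1 : psi i x - psi i y <= `|L| / s * mdist x y.
    by rewrite (le_trans (ler_norm _))// (le_trans hL).
  rewrite (@le_trans _ _ (`|L| / s * mdist x y * a i))// ?ler_wpM2r//.
  by rewrite /k mulrAC ler_wpM2r// ler_wpM2l.
apply: leeD => //; rewrite -eseries_mkcondr nneseriesZl//.
rewrite (@le_trans _ _ (k%:E * (D ^+ 5)%:E)%E)//.
  by rewrite lee_wpmul2l ?lee_fin//; exact: overlap.
by rewrite -EFinM lee_fin /k /convolution_lip mulrAC.
Qed.

End Localized.
End OneScale.

(** * The discrete maximal function *)

Lemma sup_lipschitz (R : realType) (T : pmetricType R) (J : Type) (S : set J)
    (phi : J -> T -> R) (K : R) : S !=set0 ->
  (forall j x y, phi j x <= phi j y + K * mdist x y) ->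
  (forall x, has_ubound [set phi j x | j in S]) ->
  forall x y, `|sup [set phi j x | j in S] - sup [set phi j y | j in S]|
    <= K * mdist x y.
Proof.
move=> [j0 Sj0] hK ub.
have half x y : sup [set phi j x | j in S] <=
    sup [set phi j y | j in S] + K * mdist x y.
  apply: ge_sup; first by exists (phi j0 x), j0.
  move=> _ [j Sj <-]; apply: le_trans (hK j x y) _; rewrite lerD2r.
  by apply: ub_le_sup => //; exists j.
move=> x y; have h1 := half x y; have h2 := half y x.
by rewrite (dist_sym y) in h2; rewrite ler_norml; apply/andP; split; lra.
Qed.

Section MaximalFunction.
Context (R : realType) (T : pmetricType R) (mu : {outer_measure set T -> \bar R}).
Context (mms : metric_measure_space mu).
Context (D : R) (D0 : 0 < D).
Context (dblD : forall (x : T) (r : R), 0 < r ->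
  (mu (ball x (2 * r)) <= D%:E * mu (ball x r))%E).
Local Notation m := (cara_measure mu).
Context (f : T -> R) (fL1 : integrable_fun mu f).
Context (C L : R) (P : R -> ball_partition T).
Context (admP : forall r : R, 0 < r -> admissible_partition C L r (P r)).
Context (rs : nat -> R).
Context (rsE : range rs = [set ratr q | q in [set q : rat | 0 < q]]).

Let g (x : T) := `|f x|.
Let g0 x : 0 <= g x. Proof. exact: normr_ge0. Qed.
Let ig : integrable_fun mu g. Proof. exact: integrable_norm fL1. Qed.
Let h j := discrete_convolution mu (P (rs j)) (rs j) g.
Local Notation Mf := (discrete_maximal mu P rs f).

Lemma radius_gt0 j : 0 < rs j.
Proof.
have : range rs (rs j) by exists j.
by rewrite rsE => -[q /= q0 <-]; rewrite ltr0q.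
Qed.

Lemma exists_radius (x y : R) : 0 <= x -> x < y -> exists j, x < rs j < y.
Proof.
move=> x0 xy; have [q] := rat_in_itvoo xy; rewrite in_itv/= => qxy.
have : range rs (ratr q).
  rewrite rsE; exists q => //=.
  by rewrite -(ltr0q R) (le_lt_trans x0)//; case/andP: qxy.
by move=> [j _ jq]; exists j; rewrite jq.
Qed.

Lemma convolution_le_maximal j x : (h j x <= Mf x)%E.
Proof. by apply: ereal_sup_ubound; exists j. Qed.

Lemma measurable_maximal :
  measurable_fun ([set: T] : set (caratheodory_type mu)) Mf.
Proof.
rewrite (_ : Mf = fun x => esups (fun j => h j x) 0%N).
  apply: measurable_fun_esups => j.
  exact: (measurable_convolution mms g0 (admP (radius_gt0 j))).
apply/funext => x; congr ereal_sup; apply/seteqP; split => _ [j _ <-].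
  by exists j.
by exists j.
Qed.

(** The supremum of the convolutions at scales at least [s] agrees on
    [ball x0 s] with a globally Lipschitz function. This is McShane's extension of
    that supremum, with the two suprema merged into one. *)
Lemma maximal_truncation (x0 : T) (s : R) : 0 < s -> exists G : T -> R,
  (exists K : R, forall x y, `|G x - G y| <= K * mdist x y) /\
  forall x, mdist x0 x < s -> ((G x)%:E <= Mf x)%E /\
     forall j, s <= rs j -> (h j x <= (G x)%:E)%E.
Proof.
move=> s0; pose K := convolution_lip mu D g L x0 s.
pose A := convolution_bound mu D g x0 s.
have hA j x : s <= rs j -> mdist x0 x < s -> (h j x <= A%:E)%E.
  move=> sj; have j0 := radius_gt0 j.
  exact: (convolution_le mms D0 dblD g0 ig j0 (admP j0) s0 sj).
have hL j x y : s <= rs j -> mdist x0 x < s ->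
    (h j x <= h j y + (K * mdist x y)%:E)%E.
  move=> sj; have j0 := radius_gt0 j.
  exact: (convolution_lipschitz mms D0 dblD g0 ig j0 (admP j0) s0 sj).
have h0 j x : (0 <= h j x)%E := convolution_ge0 mu g0 (admP (radius_gt0 j)) x.
have hfin j x : s <= rs j -> mdist x0 x < s -> (fine (h j x))%:E = h j x.
  move=> sj xs; rewrite fineK// ge0_fin_numE//.
  by rewrite (le_lt_trans (hA _ _ sj xs))// ltry.
have K0 : 0 <= K.
  apply: mulr_ge0; last by rewrite exprn_ge0// ltW.
  apply: mulr_ge0; first by rewrite divr_ge0// ltW.
  exact: (convolution_bound_ge0 mu D0 g0).
pose S := [set jy : nat * T | s <= rs jy.1 /\ mdist x0 jy.2 < s].
pose phi (jy : nat * T) (x : T) := fine (h jy.1 jy.2) - K * mdist x jy.2.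
have [j1 sj1] : exists j, s < rs j < s + 1.
  by apply: exists_radius; [exact: ltW|rewrite ltrDl].
have S0 : S !=set0.
  by exists (j1, x0); split => /=; [case/andP: sj1 => /ltW|rewrite mdistxx].
have phiK jy x y : phi jy x <= phi jy y + K * mdist x y.
  rewrite /phi; have := dist_triangle y x jy.2; rewrite (dist_sym y x) => tri.
  by have := ler_wpM2l K0 tri; lra.
have phiub x : has_ubound [set phi jy x | jy in S].
  exists A => _ [[j y] [/= sj ys] <-]; rewrite /phi/=.
  have := hA j y sj ys; rewrite -hfin// lee_fin => hAy.
  by rewrite (le_trans _ hAy)// gerBl mulr_ge0// mdist_ge0.
exists (fun x => sup [set phi jy x | jy in S]); split.
  by exists K; exact: sup_lipschitz.
move=> x xs; split => [|j sj].
  have [Mx|nMx] := eqVneq (Mf x) +oo%E; first by rewrite Mx leey.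
  have Mfin : Mf x \is a fin_num.
    rewrite ge0_fin_numE ?ltey//.
    exact: le_trans (h0 j1 x) (convolution_le_maximal j1 x).
  rewrite -(fineK Mfin) lee_fin; apply: ge_sup.
    by have [jy Sjy] := S0; exists (phi jy x), jy.
  move=> _ [[j y] [/= sj ys] <-]; rewrite /phi/= lerBlDr -lee_fin EFinD hfin//.
  apply: le_trans (hL j y x sj ys) _; rewrite (dist_sym y) leeD2r//.
  by rewrite fineK//; exact: convolution_le_maximal.
rewrite -hfin// lee_fin; apply: ub_le_sup => //.
by exists (j, x) => //; rewrite /phi/= mdistxx mulr0 subr0.
Qed.

(** At a Lebesgue point the convolutions at small scales are close to [g x]. So
    either the supremum over all scales is [g x] itself, or it exceeds the
    contribution of all small scales and is attained by a truncation. *)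
Lemma ae_maximal_cases (e : nat -> T)
    (de : forall x (r : R), 0 < r -> exists n, mdist x (e n) < r)
    (G : nat -> nat -> T -> R) :
  (forall n k x, mdist (e n) x < k.+1%:R^-1 -> ((G n k x)%:E <= Mf x)%E /\
     forall j, k.+1%:R^-1 <= rs j -> (h j x <= (G n k x)%:E)%E) ->
  {ae m, forall x, Mf x = (g x)%:E \/ exists n k, Mf x = (G n k x)%:E}.
Proof.
move=> hG; apply: ae_imply (ae_lebesgue_point mms D0 dblD ig) => x leb.
have near (eps : R) : 0 < eps -> exists2 d : R, 0 < d & forall j, rs j < d ->
    (h j x <= (g x + eps)%:E)%E /\ ((g x)%:E <= h j x + eps%:E)%E.
  move=> eps0; have [d d0 hd] := leb eps eps0.
  exists (d / 3); first by rewrite divr_gt0.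
  move=> j jd; have j0 := radius_gt0 j.
  apply: (convolution_near g0 (admP j0) (ltW eps0)) => i Ii px.
  apply: hd; first by rewrite mulr_gt0//=; move: jd; rewrite ltr_pdivlMr// mulrC.
  rewrite mulrA (_ : 2 * 3 = 6); last by rewrite -natrM.
  have [_ _ /(_ i Ii)[_ + _ _] _] := admP j0; rewrite -ballE; apply.
  exact: subset_closure.
have geM : ((g x)%:E <= Mf x)%E.
  apply/lee_addgt0Pr => eps eps0; have [d d0 hd] := near eps eps0.
  have [j /andP[_ jd]] := exists_radius (lexx 0) d0.
  have [_ le] := hd j jd; apply: le_trans le _.
  by rewrite leeD2r//; exact: convolution_le_maximal.
have [->|ne] := eqVneq (Mf x) (g x)%:E; [by left|right].
have ltM : ((g x)%:E < Mf x)%E by rewrite lt_neqAle eq_sym ne.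
have [eps eps0 epsM] : exists2 eps : R, 0 < eps & ((g x + eps)%:E < Mf x)%E.
  move: ltM; case: (Mf x) => [r||]//=; last by exists 1 => //; rewrite ltry.
  rewrite lte_fin => gr; exists ((r - g x) / 2); first by rewrite divr_gt0// subr_gt0.
  by rewrite lte_fin; lra.
have [d d0 hd] := near eps eps0.
pose k := Num.truncn d^-1.
have kd : k.+1%:R^-1 < d.
  by rewrite -[ltRHS]invrK ltf_pV2 ?posrE ?invr_gt0// truncnS_gt.
have [|n xn] := de x (k.+1%:R^-1); first by rewrite invr_gt0.
exists n, k; rewrite dist_sym in xn; have [GM hGj] := hG n k x xn.
apply/eqP; rewrite eq_le GM andbT leNgt; apply/negP => GltM.
have : (Mf x <= Order.max (g x + eps)%:E (G n k x)%:E)%E.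
  apply: ge_ereal_sup => _ [j _ <-]; rewrite le_max.
  have [jd|dj] := ltP (rs j) d; first by have [-> _] := hd j jd.
  by rewrite hGj ?orbT// (le_trans (ltW kd)).
by rewrite leNgt gt_max epsM GltM.
Qed.

Section Structure.
Context (Lam : countType) (N : Lam -> nat) (Xs : Lam -> set T).
Context (xs : forall a : Lam, T -> 'rV[R]_(N a)).
Context (ads : approx_diff_structure Xs xs mu).
Context (fdiff : approx_differentiable_ae Xs xs mu (EFin \o f)).

Lemma maximal_approx_differentiable : approx_differentiable_ae Xs xs mu Mf.
Proof.
have [e de] := dense_sequence mms.
have : forall nk : nat * nat, exists G : T -> R,
  (exists K : R, forall x y, `|G x - G y| <= K * mdist x y) /\
  forall x, mdist (e nk.1) x < nk.2.+1%:R^-1 -> ((G x)%:E <= Mf x)%E /\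
     forall j, nk.2.+1%:R^-1 <= rs j -> (h j x <= (G x)%:E)%E.
  by move=> nk; apply: maximal_truncation; rewrite invr_gt0.
move=> /choice[G hG].
have mf : measurable_fun ([set: T] : set (caratheodory_type mu)) f.
  by apply/measurable_EFinP; case/integrableP: fL1.
(* [|f|] is [f] or [- f], so the cases are three families of functions that are
   already known to be approximately differentiable. *)
pose GG (i : bool + nat * nat) : T -> R := match i with
  | inl true => f | inl false => fun x => - f x | inr nk => G nk end.
apply: (approx_differentiable_piecewise mms D0 dblD ads (G := GG)).
- exact: measurable_maximal.
- case=> [[]|nk] //=; first exact: measurable_funN.
  by have [[K hK] _] := hG nk; exact: (measurable_lipschitz mms hK).
- case=> [[]|nk] //=.
    apply: ae_imply fdiff => x hx a Xx; have [v hv] := hx a Xx.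
    by exists (- v); exact: approx_derivativeN.
  by have [[K hK] _] := hG nk; exact: (lipschitz_approx_differentiable ads hK).
apply: ae_imply (ae_maximal_cases de (G := fun n k => G (n, k)) _) => [x|].
  case=> [->|[n [k ->]]]; last by exists (inr (n, k)).
  have [f0|f0] := leP 0 (f x); first by exists (inl true); rewrite /g ger0_norm.
  by exists (inl false); rewrite /g ltr0_norm.
by move=> n k x; have [_ +] := hG (n, k); apply.
Qed.

End Structure.
End MaximalFunction.

(** * Approximate differentiability of the discrete maximal function *)

Unset Implicit Arguments.

Theorem theorem4p1 (R : realType) (T : pmetricType R)
  (mu : {outer_measure set T -> \bar R})
  (mms : metric_measure_space mu) (dbl : doubling mu)
  (Lam : countType) (N : Lam -> nat) (Xs : Lam -> set T)
  (xs : forall a : Lam, T -> 'rV[R]_(N a))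
  (ads : approx_diff_structure Xs xs mu)
  (C L : R) (C_gt0 : 0 < C) (P : R -> ball_partition T)
  (admP : forall r : R, 0 < r -> admissible_partition C L r (P r))
  (rs : nat -> R)
  (rsE : range rs = [set ratr q | q in [set q : rat | 0 < q]])
  (f : T -> R) (fL1 : integrable_fun mu f)
  (fdiff : approx_differentiable_ae Xs xs mu (EFin \o f)) :
  approx_differentiable_ae Xs xs mu (discrete_maximal mu P rs f).
Proof.
have [D D0 dblD] := dbl.
exact: (maximal_approx_differentiable mms D0 dblD fL1 admP rsE ads fdiff).
Qed.
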